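(* Let $S$ be a compact, connected, non-positively curved special cube complex, $\Gamma$ its fundamental group, $X$ its universal covering, $\ell$ a $\Gamma$-invariant admissible edge labeling on $X$, and $o\in X^{(0)}$. Let $({}_v\sigma)_{v\in\mathcal L_o^{cube}}$ be a portrait in $\mathcal L_o^{cube}$. There exists some $g\in G_o$ such that $({}_v\sigma)_{v\in\mathcal L_o^{cube}}$ is the portrait of $g$ if and only if $({}_v\sigma)_{v\in\mathcal L_o^{cube}}$ is admissible, defines an automorphism on $T_o^{cube}$, and satisfies (par) and (inv).
   Context: $\mathrm{Aut}(X)$ is the group of cubical automorphisms of $X$; $G_o$ is the stabilizer of $o$ in $\mathrm{Aut}(X)$. ''Special'' is in the sense of Haglund--Wise (hyperplanes are embedded and two-sided, do not directly self-osculate, and do not inter-osculate). Labelings. $\vec{\mathcal E}(X)$ is the set of oriented edges, $\vec{\mathcal E}(X)_v$ those starting at $v$. Oriented edges are parallel if they cross the same hyperplane in the same direction. Two edges with exactly one common endpoint span a square if they are two sides of a common square. An admissible edge labeling is a map $\ell:\vec{\mathcal E}(X)\to\Sigma_0$ to a finite set $\Sigma_0$ with fixpoint-free involution $s\mapsto s^{-1}$ such that: (A1) parallel oriented edges have equal labels and reversing orientation inverts the label; (A2) $\ell|_{\vec{\mathcal E}(X)_v}$ is injective for each vertex $v$; (A3) if $e_1,e_2\in\vec{\mathcal E}(X)_v$, $e_1',e_2'\in\vec{\mathcal E}(X)_w$ with $\ell(e_i)=\ell(e_i')$ for $i=1,2$, then $e_1,e_2$ span a square iff $e_1',e_2'$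 do. It is $\Gamma$-invariant if $\ell(g(e))=\ell(e)$ for all $g\in\Gamma$ and all $e$. Labels and words. $\Sigma_{0,v}=\ell(\vec{\mathcal E}(X)_v)$. Labels $s,t\in\Sigma_0$ commute, $[s,t]=1$, if at some vertex there are outgoing edges labeled $s$ and $t$ spanning a square. A label is isolated if it commutes with no element of $\Sigma_0$. $\Sigma$ is the set of nonempty subsets of $\Sigma_0$ whose distinct elements commute pairwise; $s\in\Sigma_0$ is identified with $\{s\}$. An oriented diagonal is an ordered pair of opposite vertices $(v,w)$ of a cube $C$ of dimension $\ge1$; its label is the set of labels of the edges of $C$ starting at $v$. $\Sigma_v\subset\Sigma$ is the set of labels of oriented diagonals starting at $v$. For $\alpha,\beta\in\Sigma_v$, $[\alpha,\beta]=1$ means every $s\in\alpha$ commutes with every $t\in\beta$. A cube path is a finite concatenation of oriented diagonals; its word is the sequence of labels. $\mathcal L_o^{cube}\subset\Sigma^*$ is the set of words of cube paths starting at $o$ (each word determines its path); $\epsilon$ is the empty word. A word $v\in\mathcal L_o^{cube}$ also denotes the endpoint of its path, and $\Sigma_v,\Sigma_{0,v}$ refer to this endpoint; thus $\Sigma_v=\{\alpha\in\Sigma\mid v\alpha\in\mathcal L_o^{cube}\}$. $v\equiv_ow$ means that the paths of $v,w\in\mathcal L_o^{cube}$ have the same endpoint. $T_o^{cube}$ is the rooted tree with vertex set $\mathcal L_o^{cube}$, root $\epsilon$, and an edge from $v$ to $v\alpha$ for all $v\in\mathcal L_o^{cube}$, $\alpha\in\Sigma_v$. Portraits. A portrait in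 $\mathcal L_o^{cube}$ is a family of injective maps ${}_v\sigma:\Sigma_v\to\Sigma$, $v\in\mathcal L_o^{cube}$. It induces $\sigma:\mathcal L_o^{cube}\to\Sigma^*$, $\sigma(\alpha_1\cdots\alpha_n)={}_{\epsilon}\sigma(\alpha_1)\,{}_{\alpha_1}\sigma(\alpha_2)\cdots{}_{\alpha_1\cdots\alpha_{n-1}}\sigma(\alpha_n)$, and it defines an automorphism on $T_o^{cube}$ if $\sigma$ is the vertex map of a rooted automorphism of $T_o^{cube}$. The portrait of $g\in G_o$ is the family ${}_v\sigma(g):\Sigma_v\to\Sigma$ sending the label of an outgoing diagonal $d$ at (the endpoint of) $v$ to the label of $g(d)$. A label-morphism is an injective map $\sigma:\Sigma_{0,v}\to\Sigma_0$ with $[s,t]=1\Leftrightarrow[\sigma(s),\sigma(t)]=1$ for all $s,t\in\Sigma_{0,v}$; its canonical extension to $\Sigma_v$ is $\{s_1,\dots,s_n\}\mapsto\{\sigma(s_1),\dots,\sigma(s_n)\}$. A portrait in $\mathcal L_o^{cube}$ is admissible if ${}_v\sigma={}_w\sigma$ whenever $v\equiv_ow$, and for every $v$ the restriction of ${}_v\sigma$ to $\Sigma_{0,v}$ is a label-morphism whose canonical extension is ${}_v\sigma$. For an admissible portrait defining an automorphism on $T_o^{cube}$: (par) for all $v\in\mathcal L_o^{cube}$, all non-isolated $s\in\Sigma_{0,v}$ and all $\beta\in\Sigma_v$ with $[\beta,s]=1$: ${}_v\sigma(\beta)={}_{vs}\sigma(\beta)$. (inv) for all $\alpha_1\cdots\alpha_n\in\mathcal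 L_o^{cube}$ and $s\in\alpha_n$: ${}_{\alpha_1\cdots\alpha_n}\sigma(s^{-1})=\big({}_{\alpha_1\cdots\alpha_{n-1}\tilde\alpha_n}\sigma(s)\big)^{-1}$, where $\tilde\alpha_n=\alpha_n\setminus\{s\}$ (omitted if empty). *)

(* Defs.v *)
From Stdlib Require FinFun Relations.
From mathcomp Require Import all_boot.

Set Implicit Arguments.
Unset Strict Implicit.
Unset Printing Implicit Defensive.

(* Cubes and their face inclusions.  A face inclusion [0,1]^m -> [0,1]^n,
   composed with any symmetry of the source, is encoded by its restriction to
   the vertices; these restrictions are exactly the maps {0,1}^m -> {0,1}^n
   preserving the Hamming distance.  In particular face_map n n is the full
   symmetry group of the n-cube. *)

Definition vtx (n : nat) := {ffun 'I_n -> bool}.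

Definition hamming (n : nat) (a b : vtx n) : nat := #|[set i | a i != b i]|.

Definition isometric (m n : nat) (f : {ffun vtx m -> vtx n}) : bool :=
  [forall a, forall b, hamming (f a) (f b) == hamming a b].

Definition face_map (m n : nat) := {f : {ffun vtx m -> vtx n} | isometric f}.

Lemma isometricP (m n : nat) (f : {ffun vtx m -> vtx n}) :
  reflect (forall a b, hamming (f a) (f b) = hamming a b) (isometric f).
Proof.
apply: (iffP forallP) => [H a b|H a]; first by move/forallP: (H a) => /(_ b)/eqP.
by apply/forallP => b; apply/eqP.
Qed.

Lemma fid_subproof (n : nat) : isometric [ffun a : vtx n => a].
Proof. by apply/isometricP => a b; rewrite !ffunE. Qed.

Definition fid (n : nat) : face_map n n :=
  exist (fun f => isometric f) _ (fid_subproof n).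

Lemma fcomp_subproof (l m n : nat) (f : face_map m n) (g : face_map l m) :
  isometric [ffun a => sval f (sval g a)].
Proof.
apply/isometricP => a b; rewrite !ffunE.
by rewrite (isometricP _ (svalP f)) (isometricP _ (svalP g)).
Qed.

Definition fcomp (l m n : nat) (f : face_map m n) (g : face_map l m) : face_map l n :=
  exist (fun f => isometric f) _ (fcomp_subproof f g).

Lemma vertex_map_subproof (n : nat) (a : vtx n) : isometric [ffun _ : vtx 0 => a].
Proof.
apply/isometricP => u v; rewrite !ffunE /hamming.
have -> : [set i | a i != a i] = set0 by apply/setP => i; rewrite !inE eqxx.
by rewrite cards0; apply/esym/eqP; rewrite cards_eq0; apply/eqP/setP => -[].
Qed.

Definition vertex_map (n : nat) (a : vtx n) : face_map 0 n :=
  exist (fun f => isometric f) _ (vertex_map_subproof a).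

Lemma edge_map_subproof (n : nat) (a : vtx n) (i : 'I_n) :
  isometric [ffun u : vtx 1 => [ffun j => a j (+) ((j == i) && u ord0)]].
Proof.
apply/isometricP => u v; rewrite !ffunE /hamming.
case: (boolP (u ord0 == v ord0)) => huv.
  rewrite (_ : [set _ | _] = set0); last first.
    by apply/setP => j; rewrite !inE !ffunE (eqP huv) eqxx.
  rewrite cards0; apply/esym/eqP; rewrite cards_eq0; apply/eqP/setP => j.
  by rewrite !inE (ord1 j) huv.
rewrite (_ : [set _ | _] = [set i]); last first.
  apply/setP => j; rewrite !inE !ffunE; case: (j == i) => /=; last by rewrite eqxx.
  by move: huv; case: (a j); case: (u ord0); case: (v ord0).
rewrite (_ : [set _ | _] = [set ord0]) ?cards1 //.
by apply/setP => j; rewrite !inE (ord1 j) huv.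
Qed.

(* The edge of the n-cube that starts at a and points in direction i. *)
Definition edge_map (n : nat) (a : vtx n) (i : 'I_n) : face_map 1 n :=
  exist (fun f => isometric f) _ (edge_map_subproof a i).

Definition vzero (n : nat) : vtx n := [ffun=> false].
Definition vunit (n : nat) (i : 'I_n) : vtx n := [ffun j => j == i].
Definition vopp (n : nat) (a : vtx n) : vtx n := [ffun j => ~~ a j].

(* A cube complex, i.e. a cell complex obtained by gluing cubes along faces by
   isometries.  An element of cell n is an n-cube of the complex together with
   a parametrization by [0,1]^n (so every n-cube occurs 2^n n! times in
   cell n); res f c is the face of c parametrized through f.  The axiom
   res_free says that no cube is glued to itself by a nontrivial symmetry.
   Cubes need not be embedded, and distinct cubes may share their boundary. *)
Record cube_complex := CubeComplex {
  cell : nat -> Type;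
  res : forall m n : nat, face_map m n -> cell n -> cell m;
  res_id : forall (n : nat) (c : cell n), res (fid n) c = c;
  res_comp : forall (l m n : nat) (f : face_map m n) (g : face_map l m) (c : cell n),
    res (fcomp f g) c = res g (res f c);
  res_free : forall (n : nat) (f : face_map n n) (c : cell n),
    res f c = c -> f = fid n
}.

Section CubeComplexes.
Context {X : cube_complex}.

Definition vertex := cell X 0.
(* Oriented edges: a parametrization of an edge is an orientation. *)
Definition edge := cell X 1.

Definition corner (n : nat) (c : cell X n) (a : vtx n) : vertex :=
  res (vertex_map a) c.
Definition cedge (n : nat) (c : cell X n) (a : vtx n) (i : 'I_n) : edge :=
  res (edge_map a i) c.
Definition axis (n : nat) (c : cell X n) (i : 'I_n) : edge := cedge c (vzero n) i.

Definition src (e : edge) : vertex := corner e (vzero 1).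
Definition tgt (e : edge) : vertex := corner e (vunit ord0).
Definition redge (e : edge) : edge := cedge e (vunit ord0) ord0.

Definition sq0 : 'I_2 := ord0.
Definition sq1 : 'I_2 := ord_max.

Fixpoint is_path (x : vertex) (p : seq edge) (y : vertex) : Prop :=
  if p is e :: q then src e = x /\ is_path (tgt e) q y else x = y.

Definition connected : Prop := forall x y : vertex, exists p, is_path x p y.

Inductive homotopy_move (x y : vertex) : seq edge -> seq edge -> Prop :=
| move_backtrack p e q :
    is_path x (p ++ q) y -> is_path x (p ++ [:: e; redge e] ++ q) y ->
    homotopy_move x y (p ++ [:: e; redge e] ++ q) (p ++ q)
| move_square p (c : cell X 2) q :
    is_path x (p ++ [:: axis c sq0; cedge c (vunit sq0) sq1] ++ q) y ->
    homotopy_move x y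
      (p ++ [:: axis c sq0; cedge c (vunit sq0) sq1] ++ q)
      (p ++ [:: axis c sq1; cedge c (vunit sq1) sq0] ++ q).

Definition homotopic (x y : vertex) : seq edge -> seq edge -> Prop :=
  Relation_Operators.clos_refl_sym_trans _ (homotopy_move x y).

Definition simply_connected : Prop :=
  connected /\ forall (x : vertex) p, is_path x p x -> homotopic x x p [::].

(* Finitely many cubes in total. *)
Definition compact : Prop := FinFun.Finite {n : nat & cell X n}.

Definition corner_square (e f : edge) : Prop :=
  exists c : cell X 2, axis c sq0 = e /\ axis c sq1 = f.

(* Vertex links are flag simplicial complexes: the vertices of the link of x
   are the oriented edges starting at x, and its simplices are the corners at x
   of cubes; up to reparametrization the corner is the origin of the cube. *)
Definition nonpositively_curved : Prop :=
  [/\ forall n (c : cell X n), injective (axis c),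
      forall n (c d : cell X n), corner c (vzero n) = corner d (vzero n) ->
        (forall i, axis c i = axis d i) -> c = d
    & forall (x : vertex) n (e : 'I_n -> edge), (forall i, src (e i) = x) ->
        (forall i j, i != j -> corner_square (e i) (e j)) ->
        exists c : cell X n, corner c (vzero n) = x /\ forall i, axis c i = e i].

Definition elementary_parallel (e f : edge) : Prop :=
  exists c : cell X 2, axis c sq0 = e /\ cedge c (vunit sq1) sq0 = f.

(* Crossing the same hyperplane in the same direction. *)
Definition parallel : edge -> edge -> Prop :=
  Relation_Operators.clos_refl_sym_trans _ elementary_parallel.

Definition same_hyperplane (e f : edge) : Prop := parallel e f \/ parallel e (redge f).

(* Below, a hyperplane is represented by an oriented edge dual to it. *)

Definition self_intersects (h : edge) : Prop :=
  exists c : cell X 2,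
    same_hyperplane h (axis c sq0) /\ same_hyperplane h (axis c sq1).

Definition one_sided (h : edge) : Prop := parallel h (redge h).

Definition directly_self_osculates (h : edge) : Prop :=
  exists e f : edge, [/\ same_hyperplane h e, parallel e f, src e = src f,
    e <> f & ~ corner_square e f].

Definition cross (h k : edge) : Prop :=
  exists e f : edge, [/\ same_hyperplane h e, same_hyperplane k f
    & corner_square e f].

Definition osculate (h k : edge) : Prop :=
  exists e f : edge, [/\ same_hyperplane h e, same_hyperplane k f,
    src e = src f, e <> f & ~ corner_square e f].

Definition inter_osculate (h k : edge) : Prop :=
  [/\ ~ same_hyperplane h k, cross h k & osculate h k].

Definition special : Prop :=
  [/\ forall h : edge, ~ self_intersects h,
      forall h : edge, ~ one_sided h,
      forall h : edge, ~ directly_self_osculates h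
    & forall h k : edge, ~ inter_osculate h k].

Definition is_endpoint (x : vertex) (e : edge) : Prop := x = src e \/ x = tgt e.

Definition is_side (n : nat) (c : cell X n) (e : edge) : Prop :=
  exists a i, cedge c a i = e.

Definition span_square (e f : edge) : Prop :=
  (exists! x, is_endpoint x e /\ is_endpoint x f) /\
  exists c : cell X 2, is_side c e /\ is_side c f.

End CubeComplexes.

Arguments vertex : clear implicits.
Arguments edge : clear implicits.
Arguments connected : clear implicits.
Arguments simply_connected : clear implicits.
Arguments compact : clear implicits.
Arguments nonpositively_curved : clear implicits.
Arguments special : clear implicits.

Record morphism (X Y : cube_complex) := Morphism {
  mor :> forall n : nat, cell X n -> cell Y n;
  mor_res : forall (m n : nat) (f : face_map m n) (c : cell X n),
    mor (res f c) = res f (mor c)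
}.

Arguments mor {X Y} m n c : rename.

Definition automorphism (X : cube_complex) (g : morphism X X) : Prop :=
  forall n, bijective (g n).

(* The corners at x of cubes of X correspond bijectively, under p, to the
   corners at p x of cubes of S. *)
Definition covering (X S : cube_complex) (p : morphism X S) : Prop :=
  (forall s : vertex S, exists x : vertex X, p 0 x = s) /\
  forall n (a : vtx n) (d : cell S n) (x : vertex X), p 0 x = corner d a ->
    exists! c : cell X n, p n c = d /\ corner c a = x.

Definition universal_covering (X S : cube_complex) (p : morphism X S) : Prop :=
  covering p /\ simply_connected X.

(* The fundamental group of S acts on X as the group of these automorphisms. *)
Definition deck_transformation (X S : cube_complex) (p : morphism X S)
    (g : morphism X X) : Prop :=
  automorphism g /\ forall n (c : cell X n), p n (g n c) = p n c.

Section Labelings.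
Context {X : cube_complex} {Sig0 : finType}.
Context (inv : Sig0 -> Sig0) (ell : edge X -> Sig0).

Definition fixpoint_free_involution : Prop :=
  involutive inv /\ forall s, inv s <> s.

Definition labeling_A1 : Prop :=
  (forall e f : edge X, parallel e f -> ell e = ell f) /\
  (forall e : edge X, ell (redge e) = inv (ell e)).

Definition labeling_A2 : Prop :=
  forall e f : edge X, src e = src f -> ell e = ell f -> e = f.

Definition labeling_A3 : Prop :=
  forall e1 e2 f1 f2 : edge X, src e1 = src e2 -> src f1 = src f2 ->
    ell e1 = ell f1 -> ell e2 = ell f2 -> (span_square e1 e2 <-> span_square f1 f2).

Definition admissible_labeling : Prop :=
  [/\ labeling_A1, labeling_A2 & labeling_A3].

Definition lcommute (s t : Sig0) : Prop :=
  exists e f : edge X, [/\ src e = src f, ell e = s, ell f = t & span_square e f].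

Definition lcommute_set (a b : {set Sig0}) : Prop :=
  forall s t, s \in a -> t \in b -> lcommute s t.

Definition isolated (s : Sig0) : Prop := forall t, ~ lcommute s t.

Definition in_Sigma (a : {set Sig0}) : Prop :=
  a != set0 /\ forall s t, s \in a -> t \in a -> s <> t -> lcommute s t.

(* (x, y) is an oriented diagonal with label a. *)
Definition diagonal (x y : vertex X) (a : {set Sig0}) : Prop :=
  exists n (c : cell X n) (u : vtx n),
    [/\ 0 < n, corner c u = x, corner c (vopp u) = y
      & a = [set ell (cedge c u i) | i : 'I_n]].

Definition word := seq {set Sig0}.

(* w is the word of a cube path from x to y. *)
Fixpoint cube_path (x : vertex X) (w : word) (y : vertex X) : Prop :=
  if w is a :: w' then exists z, diagonal x z a /\ cube_path z w' y else x = y.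

Definition label_invariant (S : cube_complex) (p : morphism X S) : Prop :=
  forall g : morphism X X, deck_transformation p g ->
    forall e : edge X, ell (g 1 e) = ell e.

Section BasePoint.
Context (o : vertex X).

Definition Lcube (w : word) : Prop := exists x, cube_path o w x.

Definition word_equiv (v w : word) : Prop :=
  exists x, cube_path o v x /\ cube_path o w x.

Definition Sigma_at (v : word) (a : {set Sig0}) : Prop :=
  exists x y, cube_path o v x /\ diagonal x y a.

Definition Sigma0_at (v : word) (s : Sig0) : Prop :=
  exists x (e : edge X), [/\ cube_path o v x, src e = x & ell e = s].

(* Portraits are total functions of v and a; only the values with v in
   Lcube and a in Sigma_at v are meaningful, and no definition below depends
   on the others. *)
Definition portrait_family := word -> {set Sig0} -> {set Sig0}.

Definition is_portrait (sg : portrait_family) : Prop :=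
  forall v, Lcube v ->
    (forall a, Sigma_at v a -> in_Sigma (sg v a)) /\
    (forall a b, Sigma_at v a -> Sigma_at v b -> sg v a = sg v b -> a = b).

Definition induced (sg : portrait_family) (w : word) : word :=
  mkseq (fun i => sg (take i w) (nth set0 w i)) (size w).

Definition tree_child (v w : word) : Prop :=
  Lcube v /\ exists a, Sigma_at v a /\ w = rcons v a.

Definition tree_adjacent (v w : word) : Prop := tree_child v w \/ tree_child w v.

Definition rooted_tree_automorphism (F : word -> word) : Prop :=
  [/\ forall v, Lcube v -> Lcube (F v),
      forall v w, Lcube v -> Lcube w -> F v = F w -> v = w,
      forall w, Lcube w -> exists v, Lcube v /\ F v = w,
      F [::] = [::]
    & forall v w, Lcube v -> Lcube w ->
        (tree_adjacent v w <-> tree_adjacent (F v) (F w))].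

Definition defines_tree_automorphism (sg : portrait_family) : Prop :=
  rooted_tree_automorphism (induced sg).

Definition label_morphism (v : word) (tau : Sig0 -> Sig0) : Prop :=
  (forall s t, Sigma0_at v s -> Sigma0_at v t -> tau s = tau t -> s = t) /\
  (forall s t, Sigma0_at v s -> Sigma0_at v t ->
     (lcommute s t <-> lcommute (tau s) (tau t))).

Definition admissible_portrait (sg : portrait_family) : Prop :=
  (forall v w, word_equiv v w -> forall a, Sigma_at v a -> sg v a = sg w a) /\
  (forall v, Lcube v -> exists tau : Sig0 -> Sig0,
     [/\ forall s, Sigma0_at v s -> sg v [set s] = [set tau s],
         label_morphism v tau
       & forall a, Sigma_at v a -> sg v a = tau @: a]).

Definition par (sg : portrait_family) : Prop :=
  forall v s b, Lcube v -> Sigma0_at v s -> ~ isolated s -> Sigma_at v b ->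
    lcommute_set b [set s] -> sg v b = sg (rcons v [set s]) b.

(* The word is w a, with last letter a; both sides are singletons. *)
Definition inv_condition (sg : portrait_family) : Prop :=
  forall w a s, Lcube (rcons w a) -> s \in a ->
    sg (rcons w a) [set inv s] =
    inv @: sg (if a :\ s == set0 then w else rcons w (a :\ s)) [set s].

(* For a diagonal (x, y) at the endpoint x of v, labeled a, the diagonal
   (g x, g y) is labeled sg v a. *)
Definition portrait_of (g : morphism X X) (sg : portrait_family) : Prop :=
  forall v x y a, cube_path o v x -> diagonal x y a ->
    diagonal (g 0 x) (g 0 y) (sg v a).

End BasePoint.
End Labelings.

Arguments portrait_family : clear implicits.
Arguments word : clear implicits.

(* Main.v *)
(* A state carried along edge paths that is unchanged by backtracking and agrees
   on the two halves of the boundary of every square depends only on the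
   endpoint of the path, because X is simply connected.  This principle is used
   three times.
   - The signed number of edges labeled s gives a height function on the
     vertices.  It shows that the corners of a cube are distinct and that the
     label of a diagonal is determined by its endpoints, so that the portrait of
     an automorphism can be read off from the cubes; (par) and (inv) then follow
     since an automorphism preserves parallelism and reversal of edges.
   - Conversely, an admissible portrait prescribes how to move the image vertex
     along an edge path.  Backtracking is harmless by (inv), squares by (par), so
     this defines a map on vertices, and flagness of the links extends it to
     cubes.
   - That map is bijective on links since the portrait acts by a tree
     automorphism.  Hence edge paths lift uniquely along it, and the endpoint of
     the lift gives its inverse. *)

From Stdlib Require Import ClassicalEpsilon IndefiniteDescription.
Require Import Defs.
From mathcomp Require Import all_boot all_order all_algebra.

Set Implicit Arguments.
Unset Strict Implicit.
Unset Printing Implicit Defensive.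


(** * Faces of cubes *)

Definition flip (n : nat) (a : vtx n) (i : 'I_n) : vtx n :=
  [ffun j => a j (+) (j == i)].

Lemma flip_vzero (n : nat) (i : 'I_n) : flip (vzero n) i = vunit i.
Proof. by apply/ffunP => j; rewrite !ffunE. Qed.

Lemma flip_flip (n : nat) (a : vtx n) (i : 'I_n) : flip (flip a i) i = a.
Proof. by apply/ffunP => j; rewrite !ffunE -addbA addbb addbF. Qed.

(** Induction on the number of coordinates equal to [true]. It carries a fact from the origin of a
    cube to all corners, one edge at a time. *)
Lemma vtx_ind (n : nat) (P : vtx n -> Prop) :
  P (vzero n) -> (forall (a : vtx n) i, a i = false -> P a -> P (flip a i)) ->
  forall a, P a.
Proof.
move=> P0 Pflip a; have [k] := ubnP #|[set i | a i]|.
elim: k a => // k IHk a; rewrite ltnS => le_ak.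
case: (pickP a) => [i ai | a0]; last first.
  by suff -> : a = vzero n by []; apply/ffunP => i; rewrite ffunE; apply: a0.
rewrite -(flip_flip a i); apply: Pflip; first by rewrite ffunE ai eqxx.
apply: IHk; apply: leq_trans le_ak; apply: proper_card; apply/properP; split.
  apply/subsetP => j; rewrite !inE ffunE.
  by have [->|_] := eqVneq j i; [rewrite ai | rewrite addbF].
by exists i; rewrite !inE // ffunE ai eqxx.
Qed.

Lemma face_map_eq (m n : nat) (f g : face_map m n) :
  (forall u, sval f u = sval g u) -> f = g.
Proof. by move=> fg; apply/val_inj/ffunP. Qed.

Lemma edge_mapE (n : nat) (a : vtx n) (i : 'I_n) u :
  sval (edge_map a i) u = if u ord0 then flip a i else a.
Proof.
rewrite ffunE; apply/ffunP => j; rewrite ffunE.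
by case: (u ord0); rewrite ?andbT ?andbF ?addbF // ffunE.
Qed.

Lemma face_map1P (n : nat) (h : face_map 1 n) :
  exists i, h = edge_map (sval h (vzero 1)) i.
Proof.
have /eqP/cards1P[i hi] : hamming (sval h (vzero 1)) (sval h (vunit ord0)) = 1.
  rewrite (isometricP _ (svalP h)) /hamming (_ : [set _ | _] = [set ord0]) ?cards1 //.
  by apply/setP => j; rewrite !inE !ffunE (ord1 j).
exists i; apply: face_map_eq => u; rewrite edge_mapE.
case u0: (u ord0).
  have -> : u = vunit ord0 by apply/ffunP => j; rewrite (ord1 j) u0 ffunE.
  apply/ffunP => j; move/setP/(_ j): hi; rewrite !inE ffunE => <-.
  by do 2!case: (sval h _ j).
by congr (sval h _); apply/ffunP => j; rewrite (ord1 j) u0 ffunE.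
Qed.

(** The face through [a] whose direction [i] is the direction [phi i] of the large cube. For [phi]
    the identity it recenters the cube at [a]. *)
Definition subface_fun (m n : nat) (a : vtx n) (phi : 'I_m -> 'I_n) (u : vtx m) :
  vtx n := [ffun k => a k (+) [exists i, u i && (phi i == k)]].

Lemma subface_in (m n : nat) (a : vtx n) (phi : 'I_m -> 'I_n) u i :
  injective phi -> subface_fun a phi u (phi i) = a (phi i) (+) u i.
Proof.
move=> phiI; rewrite ffunE; congr (_ (+) _); apply/existsP/idP.
  by case=> j /andP[uj /eqP/phiI <-].
by move=> ui; exists i; rewrite ui eqxx.
Qed.

Lemma subface_notin (m n : nat) (a : vtx n) (phi : 'I_m -> 'I_n) u k :
  (forall i, phi i != k) -> subface_fun a phi u k = a k.
Proof.
move=> phik; rewrite ffunE; case: existsP => [[i]|]; last by rewrite addbF.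
by rewrite (negPf (phik i)) andbF.
Qed.

Lemma subface_cases (m n : nat) (phi : 'I_m -> 'I_n) k :
  (exists i, k = phi i) \/ (forall i, phi i != k).
Proof.
case: (pickP (fun i => phi i == k)) => [i /eqP <-|H]; first by left; exists i.
by right=> i; rewrite H.
Qed.

Lemma subface_subproof (m n : nat) (a : vtx n) (phi : 'I_m -> 'I_n) :
  injective phi -> isometric [ffun u => subface_fun a phi u].
Proof.
move=> phiI; apply/isometricP => u v; rewrite !ffunE /hamming.
rewrite -(card_imset (mem [set i | u i != v i]) phiI).
apply: eq_card => k; rewrite !inE.
case: (subface_cases phi k) => [[i ->]|phik].
  by rewrite !subface_in // (inj_eq (@addbI _)) mem_imset // inE.
rewrite !subface_notin // eqxx; apply/esym/imsetP => -[i _ ki].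
by have := phik i; rewrite ki eqxx.
Qed.

Definition subface (m n : nat) (a : vtx n) (phi : 'I_m -> 'I_n)
    (phiI : injective phi) : face_map m n :=
  exist (fun f => isometric f) _ (subface_subproof a phiI).

Lemma subfaceE (m n : nat) (a : vtx n) (phi : 'I_m -> 'I_n) (phiI : injective phi) u :
  sval (subface a phiI) u = subface_fun a phi u.
Proof. by rewrite ffunE. Qed.

Lemma subface0 (m n : nat) (a : vtx n) (phi : 'I_m -> 'I_n) :
  subface_fun a phi (vzero m) = a.
Proof.
apply/ffunP => k; rewrite ffunE; case: existsP => [[i]|_]; last exact: addbF.
by rewrite ffunE.
Qed.

Lemma subface_id (n : nat) (a u : vtx n) :
  subface_fun a id u = [ffun k => a k (+) u k].
Proof. by apply/ffunP => k; rewrite subface_in // ffunE. Qed.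

Lemma subface_flip (m n : nat) (a : vtx n) (phi : 'I_m -> 'I_n) u i :
  injective phi ->
  subface_fun a phi (flip u i) = flip (subface_fun a phi u) (phi i).
Proof.
move=> phiI; apply/ffunP => k; rewrite [RHS]ffunE.
case: (subface_cases phi k) => [[j ->]|phik].
  by rewrite !subface_in // ffunE addbA (inj_eq phiI).
by rewrite !subface_notin // eq_sym (negPf (phik i)) addbF.
Qed.

(** * Corners, edges and squares of cells *)

Section Cells.
Variable X : cube_complex.

Lemma corner_res (m n : nat) (f : face_map m n) (c : cell X n) a :
  corner (res f c) a = corner c (sval f a).
Proof.
rewrite /corner -res_comp; congr (res _ c).
by apply: face_map_eq => u; rewrite !ffunE.
Qed.

(** The direction [j] is found before the cube [c] is given, so a cube and its image share it. *)
Lemma cedge_res (m n : nat) (f : face_map m n) a i :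
  exists j, forall (c : cell X n), cedge (res f c) a i = cedge c (sval f a) j.
Proof.
case: (face_map1P (fcomp f (edge_map a i))) => j fE; exists j => c.
rewrite /cedge -res_comp fE; congr (res (edge_map _ _) c).
by rewrite ffunE edge_mapE ffunE.
Qed.

Lemma cedge_subface (m n : nat) (a : vtx n) (phi : 'I_m -> 'I_n)
    (phiI : injective phi) (c : cell X n) u i :
  cedge (res (subface a phiI) c) u i = cedge c (subface_fun a phi u) (phi i).
Proof.
rewrite /cedge -res_comp; congr (res _ c); apply: face_map_eq => v.
rewrite [LHS]ffunE subfaceE !edge_mapE; case: (v ord0) => //.
exact: subface_flip.
Qed.

Lemma cell0E (x : cell X 0) a : corner x a = x.
Proof.
rewrite -[RHS]res_id; congr (res _ x); apply: face_map_eq => u.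
by rewrite !ffunE; apply/ffunP => -[].
Qed.

Lemma cell1E (e : edge X) : axis e ord0 = e.
Proof.
rewrite -[RHS]res_id; congr (res _ e); apply: face_map_eq => u.
rewrite edge_mapE !ffunE; apply/ffunP => j; rewrite (ord1 j).
by case u0: (u ord0); rewrite !ffunE.
Qed.

Lemma src_cedge (n : nat) (c : cell X n) a i : src (cedge c a i) = corner c a.
Proof. by rewrite /src corner_res edge_mapE ffunE. Qed.

Lemma tgt_cedge (n : nat) (c : cell X n) a i :
  tgt (cedge c a i) = corner c (flip a i).
Proof. by rewrite /tgt corner_res edge_mapE ffunE eqxx. Qed.

Lemma redge_cedge (n : nat) (c : cell X n) a i :
  redge (cedge c a i) = cedge c (flip a i) i.
Proof.
rewrite /redge /cedge -res_comp; congr (res _ c); apply: face_map_eq => u.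
rewrite [LHS]ffunE !edge_mapE; case: (u ord0).
  by rewrite !ffunE eqxx flip_flip.
by rewrite ffunE eqxx.
Qed.

Lemma src_axis (n : nat) (c : cell X n) i : src (axis c i) = corner c (vzero n).
Proof. exact: src_cedge. Qed.

Lemma tgt_axis (n : nat) (c : cell X n) i : tgt (axis c i) = corner c (vunit i).
Proof. by rewrite tgt_cedge flip_vzero. Qed.

Lemma src_redge (e : edge X) : src (redge e) = tgt e.
Proof. by rewrite src_cedge. Qed.

Lemma tgt_redge (e : edge X) : tgt (redge e) = src e.
Proof. by rewrite tgt_cedge -flip_vzero flip_flip. Qed.

Lemma redgeK (e : edge X) : redge (redge e) = e.
Proof.
by rewrite -[in LHS](cell1E e) /axis !redge_cedge flip_flip; exact: cell1E.
Qed.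

Lemma axis_recenter (n : nat) (c : cell X n) a i :
  axis (res (subface a (@inj_id _)) c) i = cedge c a i.
Proof. by rewrite /axis cedge_subface subface0. Qed.

Lemma cube_square (n : nat) (c : cell X n) a i j : i != j ->
  exists d : cell X 2,
  [/\ axis d sq0 = cedge c a i, axis d sq1 = cedge c a j,
      cedge d (vunit sq0) sq1 = cedge c (flip a i) j
    & cedge d (vunit sq1) sq0 = cedge c (flip a j) i].
Proof.
move=> neq_ij; pose phi (k : 'I_2) := if k == sq0 then i else j.
have phiI : injective phi.
  move=> k l; rewrite /phi; case: eqP => [->|nk]; case: eqP => [->|nl] // E.
  - by rewrite E eqxx in neq_ij.
  - by rewrite -E eqxx in neq_ij.
  - case: k nk l nl {E} => [[|[|//]] k2] nk [[|[|//]] l2] nl; last exact: val_inj.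
    + by case: nk; apply: val_inj.
    + by case: nk; apply: val_inj.
    + by case: nl; apply: val_inj.
exists (res (subface a phiI) c).
by rewrite /axis !cedge_subface -!flip_vzero !subface_flip // !subface0.
Qed.

Lemma corner_square_sym (e f : edge X) : corner_square e f -> corner_square f e.
Proof.
case=> c [<- <-]; have [//|d [d0 d1 _ _]] := @cube_square 2 c (vzero 2) sq1 sq0.
by exists d.
Qed.

Lemma is_path_cat (p q : seq (edge X)) x z :
  is_path x (p ++ q) z <-> exists y, is_path x p y /\ is_path y q z.
Proof.
elim: p x => [|e p IHp] x /=.
  by split=> [xz|[y [-> //]]]; exists x.
rewrite IHp; split=> [[ex [y [ey yz]]]|[y [[ex ey] yz]]]; first by exists y.
by split=> //; exists y.
Qed.

Definition rev_path (p : seq (edge X)) : seq (edge X) := [seq redge e | e <- rev p].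

Lemma is_path_rev (p : seq (edge X)) x y : is_path x p y -> is_path y (rev_path p) x.
Proof.
elim: p x => [|e p IHp] x /=; first by move->.
case=> <- /IHp IH; rewrite /rev_path rev_cons map_rcons -cats1.
by apply/is_path_cat; exists (tgt e); rewrite /= src_redge tgt_redge.
Qed.

End Cells.

(** * Transport along edge paths *)

Section Transport.
Variables (X : cube_complex) (Q : Type) (st : edge X -> Q -> Q).
(** [I x q] singles out the states that can occur over [x]; only for these must backtracking and
    squares be harmless. *)
Variable I : vertex X -> Q -> Prop.
Hypothesis st_inv : forall e q, I (src e) q -> I (tgt e) (st e q).
Hypothesis st_back : forall e q, I (src e) q -> st (redge e) (st e q) = q.
Hypothesis st_square : forall (c : cell X 2) q, I (corner c (vzero 2)) q ->
  st (cedge c (vunit sq0) sq1) (st (axis c sq0) q) =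
  st (cedge c (vunit sq1) sq0) (st (axis c sq1) q).

Definition run (p : seq (edge X)) (q : Q) : Q := foldl (fun r e => st e r) q p.

Lemma run_cat p1 p2 q : run (p1 ++ p2) q = run p2 (run p1 q).
Proof. exact: foldl_cat. Qed.

Lemma run_inv p x y q : is_path x p y -> I x q -> I y (run p q).
Proof.
elim: p x q => [|e p IHp] x q /=; first by move->.
by case=> <- /IHp IH /st_inv; apply: IH.
Qed.

Lemma run_rev p x y q : is_path x p y -> I x q -> run (rev_path p) (run p q) = q.
Proof.
elim: p x q => [//|e p IHp] x q /= [<- pth] Iq.
rewrite /rev_path rev_cons map_rcons -cats1 run_cat (IHp _ _ pth); last exact: st_inv.
exact: st_back.
Qed.

Lemma run_homotopic x y p p' q : homotopic x y p p' -> I x q -> run p q = run p' q.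
Proof.
move=> hom Iq; elim: hom => {p p'} [p p' []|//|p p' _ -> //|p p' p'' _ -> _ -> //].
- move=> p1 e p2 _ /is_path_cat[z [pz /= [ez _]]].
  by rewrite !run_cat /= st_back // ez; apply: run_inv pz Iq.
- move=> p1 c p2 /is_path_cat[z [pz /= [cz _]]].
  rewrite !run_cat /= st_square //; move: cz; rewrite src_axis => ->.
  exact: run_inv pz Iq.
Qed.

(** The loop along [p] and back along [p'] is null-homotopic, so it restores [q]; retracing [p']
    then turns [q] into [run p q]. *)
Lemma run_unique x y p p' q : simply_connected X ->
  is_path x p y -> is_path x p' y -> I x q -> run p q = run p' q.
Proof.
case=> _ sc pp pp' Iq.
have loop : is_path x (p ++ rev_path p') x.
  by apply/is_path_cat; exists y; split=> //; apply: is_path_rev.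
have := run_homotopic (sc _ _ loop) Iq; rewrite run_cat /= => E.
have rev_pathK : rev_path (rev_path p') = p'.
  by rewrite /rev_path -map_rev revK (mapK (@redgeK X)).
have Iy := run_inv pp Iq; have := run_rev (is_path_rev pp') Iy.
by rewrite rev_pathK E.
Qed.

(** The state at [x] is computed along a chosen path from [o]. The path chosen for [tgt e] may be
    replaced by the one for [src e] followed by [e]. *)
Lemma transport (o : vertex X) (q : Q) : simply_connected X -> I o q ->
  exists G : vertex X -> Q,
  [/\ G o = q, forall x, I x (G x) & forall e, G (tgt e) = st e (G (src e))].
Proof.
move=> sc Iq; have con := sc.1.
have [pt ptP] := functional_choice _ (con o).
exists (fun x => run (pt x) q); split=> [|x|e].
- exact: (@run_unique o o (pt o) [::] q).
- exact: run_inv (ptP x) Iq.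
- rewrite (@run_unique o (tgt e) _ (rcons (pt (src e)) e) q) -?cats1 //.
    by rewrite run_cat.
  by apply/is_path_cat; exists (src e).
Qed.

End Transport.


(** * Labeled cube complexes *)

Lemma mor_corner (X Y : cube_complex) (f : morphism X Y) n (c : cell X n) a :
  f 0 (corner c a) = corner (f n c) a.
Proof. exact: mor_res. Qed.

Lemma mor_cedge (X Y : cube_complex) (f : morphism X Y) n (c : cell X n) a i :
  f 1 (cedge c a i) = cedge (f n c) a i.
Proof. exact: mor_res. Qed.

Lemma covering_inj (X S : cube_complex) (p : morphism X S) n (c d : cell X n) a :
  covering p -> p n c = p n d -> corner c a = corner d a -> c = d.
Proof.
move=> [_ cov] pcd cd; have [|b [_ b_uniq]] := cov n a (p n c) (corner c a).
  exact: mor_corner.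
by rewrite -(b_uniq c) // -(b_uniq d).
Qed.

(** All three conditions concern cubes at one corner, where a covering is bijective: equalities are
    tested in [S], and the cube that fills a corner is found in [S] and lifted. *)
Lemma covering_npc (X S : cube_complex) (p : morphism X S) :
  covering p -> nonpositively_curved S -> nonpositively_curved X.
Proof.
move=> cov [S1 S2 S3]; split=> [n c i j eq_ij|n c d eq_cd ax_cd|x n e src_e sq_e].
- by apply: (S1 _ (p n c)); rewrite /axis -!mor_cedge; congr (p 1 _).
- apply: (covering_inj cov _ eq_cd); apply: S2 => [|i].
    by rewrite -!mor_corner eq_cd.
  by rewrite /axis -!mor_cedge -/(axis c i) ax_cd.
have [i|i j neq_ij|d [d0 d_ax]] := S3 (p 0 x) n (fun i => p 1 (e i)).
- by rewrite /src -mor_corner -/(src _) src_e.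
- have [c [c0 c1]] := sq_e i j neq_ij.
  by exists (p 2 c); rewrite /axis -!mor_cedge -c0 -c1.
have [//|c [[pc c0] _]] := cov.2 n (vzero n) d x.
exists c; split=> // i; apply: (covering_inj (a := vzero 1)) cov _ _.
  by rewrite mor_cedge pc; apply: d_ax.
by rewrite -!/(src _) src_e src_axis.
Qed.

(** * Labels of the edges of a cube *)

Section Labeled.
Variables (X : cube_complex) (Sig0 : finType).
Variables (inv : Sig0 -> Sig0) (ell : edge X -> Sig0).
Hypotheses (npc : nonpositively_curved X) (sc : simply_connected X).
Hypothesis inv_ffi : fixpoint_free_involution inv.
Hypothesis adm : admissible_labeling inv ell.

Let invK : involutive inv := inv_ffi.1.

Lemma ell_redge e : ell (redge e) = inv (ell e).
Proof. by case: adm => -[]. Qed.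

Lemma ell_inj e f : src e = src f -> ell e = ell f -> e = f.
Proof. by case: adm => _ A2 _; apply: A2. Qed.

Lemma ell_square (c : cell X 2) :
  ell (cedge c (vunit sq1) sq0) = ell (axis c sq0) /\
  ell (cedge c (vunit sq0) sq1) = ell (axis c sq1).
Proof.
case: adm => -[A1 _] _ _; split; apply/esym/A1; apply: Relation_Operators.rst_step.
  by exists c.
have [//|d [d0 d1 _ d2]] := @cube_square X 2 c (vzero 2) sq1 sq0.
by exists d; split; rewrite // d2 flip_vzero.
Qed.

(** A flip in a direction other than [i] moves to the opposite side of a square, which keeps the
    label; a flip in direction [i] reverses the edge. *)
Lemma ell_cedge n (c : cell X n) a i :
  ell (cedge c a i) = if a i then inv (ell (axis c i)) else ell (axis c i).
Proof.
have H (b : vtx n) : b i = false -> ell (cedge c b i) = ell (axis c i).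
  elim/vtx_ind: b => [//|b j bj IHb]; rewrite ffunE.
  have [->|neq_ij] := eqVneq i j; rewrite ?bj // addbF => bi.
  have [d [d0 _ _ d2]] := cube_square c b neq_ij.
  by rewrite -d2 (ell_square d).1 d0 IHb.
case ai: (a i); last exact: H.
by rewrite -[a](flip_flip _ i) -redge_cedge ell_redge H // ffunE ai eqxx.
Qed.

Lemma axis_inj n (c : cell X n) : injective (axis c).
Proof. by case: npc => inj _ _; apply: inj. Qed.

Lemma ell_axis_inj n (c : cell X n) : injective (fun i => ell (axis c i)).
Proof. by move=> i j /ell_inj/axis_inj; apply; rewrite !src_axis. Qed.

(** For [i] different from [j], the edges in both directions at the corner [vunit j] would have
    equal labels and coincide by (A2); but axes of a cube are distinct. *)
Lemma ell_axis_inv n (c : cell X n) i j : ell (axis c i) <> inv (ell (axis c j)).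
Proof.
have [->|neq_ij] := eqVneq i j; first by move/esym; apply: inv_ffi.2.
have ui k : vunit j k = (k == j) by rewrite ffunE.
move=> E; have : cedge c (vunit j) i = cedge c (vunit j) j.
  apply: ell_inj; first by rewrite !src_cedge.
  by rewrite !(ell_cedge c (vunit j)) !ui eqxx (negPf neq_ij).
by rewrite -!axis_recenter => /axis_inj/eqP; apply/negP.
Qed.

(** * Heights: signed counts of crossings of a label *)

Section Height.
Import GRing.Theory Num.Theory Order.TTheory.
Local Open Scope ring_scope.

Definition crossing s e : int := (ell e == s)%:Z - (ell e == inv s)%:Z.

(** Reversing an edge negates [crossing s], and opposite sides of a square have equal crossings, so
    the count does not depend on the path. *)
Lemma height_exists (o : vertex X) s :
  exists H : vertex X -> int, forall e, H (tgt e) = H (src e) + crossing s e.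
Proof.
have back e q : True -> (q + crossing s e) + crossing s (redge e) = q.
  rewrite -addrA /crossing ell_redge (inv_eq invK) (inj_eq (inv_inj invK)).
  by rewrite subrKA subrr addr0.
have [c q _|H [_ _ HE]] := @transport X int (fun e q => q + crossing s e)
  (fun _ _ => True) (fun _ _ => id) back _ o 0 sc Logic.I; last by exists H.
by rewrite /crossing (ell_square c).1 (ell_square c).2 addrAC.
Qed.

Lemma height_cube s (H : vertex X -> int) n (c : cell X n) u :
  (forall e, H (tgt e) = H (src e) + crossing s e) ->
  H (corner c u) = H (corner c (vzero n)) + \sum_(i | u i) crossing s (axis c i).
Proof.
move=> HE; elim/vtx_ind: u => [|u i ui IHu].
  by rewrite big_pred0 ?addr0 // => i; rewrite ffunE.
rewrite -tgt_cedge HE src_cedge IHu -addrA; congr (_ + _).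
rewrite [RHS](bigD1 i) /=; last by rewrite ffunE ui eqxx.
rewrite addrC /crossing ell_cedge ui; congr (_ + _); apply: eq_bigl => j.
by rewrite ffunE; have [->|_] := eqVneq j i; rewrite ?ui ?addbF ?andbT.
Qed.

(** If some axis has label [s], no axis has label [inv s], so every summand is nonnegative and a
    summand labeled [s] is 1. If no axis counted by [u] has label [s], every summand is at most
    0. *)
Lemma height_lt s (H : vertex X -> int) n (c : cell X n) u :
  (forall e, H (tgt e) = H (src e) + crossing s e) ->
  (H (corner c (vzero n)) < H (corner c u)) =
  [exists i, u i && (ell (axis c i) == s)].
Proof.
move=> HE; rewrite (height_cube c u HE) ltrDl; apply/idP/existsP.
  move=> pos; apply/existsP; apply: contraTT pos; rewrite -leNgt negb_exists.
  move=> /forallP noi; apply: sumr_le0 => i ui; have := noi i.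
  by rewrite ui /= /crossing => /negPf ->; rewrite sub0r oppr_le0.
case=> i /andP[ui /eqP si].
have crossE j : crossing s (axis c j) = (ell (axis c j) == s)%:Z.
  rewrite /crossing (_ : (_ == inv s) = false) ?subr0 //.
  by rewrite -si; apply/eqP/ell_axis_inv.
by rewrite (bigD1 i) //= crossE si eqxx ltr_pwDl // sumr_ge0 // => j _; rewrite crossE.
Qed.

End Height.

(** Recentered at [a], the cube has [b] at position [u]. A direction [i] with [u i] true makes the
    height for its label strictly larger at [b] than at [a]. *)
Lemma corner_inj n (c : cell X n) : injective (corner c).
Proof.
move=> a b cab; apply/ffunP => i; apply/eqP; apply: contraT => neq_i.
pose c' := res (subface a (@inj_id _)) c; pose u : vtx n := [ffun k => a k (+) b k].
have E : corner c' u = corner c' (vzero n).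
  rewrite !corner_res !subfaceE subface0 subface_id cab; congr (corner c _).
  by apply/ffunP => k; rewrite !ffunE addKb.
have [H HE] := height_exists (corner c a) (ell (axis c' i)).
have := height_lt c' u HE; rewrite E Order.POrderTheory.ltxx => /esym/existsP[].
by exists i; rewrite eqxx andbT ffunE; case: (a i) (b i) neq_i => -[].
Qed.

(** * Oriented diagonals and cube paths *)

Lemma diagonalP x y a :
  diagonal ell x y a <-> exists n (c : cell X n),
  [/\ 0 < n, corner c (vzero n) = x, corner c (vopp (vzero n)) = y
    & a = [set ell (axis c i) | i : 'I_n]].
Proof.
split=> [[n [c [u [n0 cx cy ->]]]]|[n [c [n0 cx cy ->]]]]; last first.
  by exists n, c, (vzero n).
exists n, (res (subface u (@inj_id _)) c); split=> //.
- by rewrite corner_res subfaceE subface0.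
- rewrite corner_res subfaceE subface_id -cy; congr (corner c _).
  by apply/ffunP => k; rewrite !ffunE addbT.
- by apply: eq_imset => i; rewrite axis_recenter.
Qed.

(** Equal label sets give a permutation [phi] matching the axes of both cubes by (A2). Uniqueness of
    cubes in the link makes [c] a reparametrization of [d] that fixes the origin, hence also the
    opposite corner. *)
Lemma diagonal_target x y z a : diagonal ell x y a -> diagonal ell x z a -> y = z.
Proof.
move=> /diagonalP[n [c [_ cx <- ->]]] /diagonalP[m [d [_ dx <- E]]].
have nm : n = m.
  have := congr1 (fun A : {set Sig0} => #|A|) E.
  by rewrite !card_imset ?card_ord //; apply: ell_axis_inj.
case: m / nm d dx E => d dx E.
have /functional_choice[phi phiE] i : exists j, ell (axis d j) = ell (axis c i).
  have : ell (axis c i) \in [set ell (axis c i) | i : 'I_n] by apply: imset_f.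
  by rewrite E => /imsetP[j _ ->]; exists j.
have phiI : injective phi.
  by move=> i j eq_phi; apply: (ell_axis_inj (c := c)); rewrite -!phiE eq_phi.
case: npc => _ cube_eq _.
have -> : c = res (subface (vzero n) phiI) d.
  apply: cube_eq => [|i]; first by rewrite corner_res subfaceE subface0 cx.
  rewrite {2}/axis cedge_subface subface0; apply: ell_inj; last by rewrite phiE.
  by rewrite !src_cedge cx.
rewrite corner_res subfaceE; congr (corner d _); apply/ffunP => k.
have /codomP[j ->] := injF_onto phiI k.
by rewrite subface_in // !ffunE.
Qed.

(** A label [s] lies in the label of a diagonal exactly if its height grows along the diagonal,
    which depends only on the two endpoints. *)
Lemma diagonal_label x y a b : diagonal ell x y a -> diagonal ell x y b -> a = b.
Proof.
have sub a' b' : diagonal ell x y a' -> diagonal ell x y b' -> a' \subset b'.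
  move=> /diagonalP[n [c [_ cx cy ->]]] /diagonalP[m [d [_ dx dy ->]]].
  apply/subsetP => s /imsetP[i _ si].
  have [H HE] := height_exists x s.
  have /existsP[j /andP[_ /eqP <-]] :
      [exists j, vopp (vzero m) j && (ell (axis d j) == s)].
    rewrite -(height_lt d _ HE) dx dy -cx -cy (height_lt c _ HE).
    by apply/existsP; exists i; rewrite si !ffunE eqxx.
  exact: imset_f.
by move=> da db; apply/eqP; rewrite eqEsubset !sub.
Qed.

Lemma edge_diagonal e : diagonal ell (src e) (tgt e) [set ell e].
Proof.
apply/diagonalP; exists 1, e; split=> //.
  by congr (corner e _); apply/ffunP => i; rewrite !ffunE (ord1 i).
apply/setP => s; rewrite inE; apply/eqP/imsetP => [->|[i _ ->]].
  by exists ord0; rewrite ?cell1E.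
by rewrite (ord1 i) cell1E.
Qed.

Lemma diagonal_edge x y s : diagonal ell x y [set s] ->
  exists e, [/\ src e = x, tgt e = y & ell e = s].
Proof.
move=> /diagonalP[n [c [n0 cx cy E]]].
have n1 : n = 1.
  have := congr1 (fun A : {set Sig0} => #|A|) E.
  by rewrite cards1 card_imset ?card_ord //; apply: ell_axis_inj.
subst n; exists c; split=> //.
  by rewrite -cy; congr (corner c _); apply/ffunP => i; rewrite !ffunE (ord1 i).
have : ell (axis c ord0) \in [set s] by rewrite E imset_f.
by rewrite inE cell1E => /eqP.
Qed.

Lemma cube_path_fun x w y z : cube_path ell x w y -> cube_path ell x w z -> y = z.
Proof.
elim: w x => [|a w IHw] x /=; first by move=> <- <-.
by move=> [u [xu uy]] [v [xv /(IHw _) H]]; apply: H; rewrite -(diagonal_target xu xv).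
Qed.

Lemma cube_path_rcons x w a z :
  cube_path ell x (rcons w a) z <-> exists y, cube_path ell x w y /\ diagonal ell y z a.
Proof.
elim: w x => [|b w IHw] x /=.
  split=> [[y [xy <-]]|[y [-> yz]]]; first by exists x.
  by exists z.
split=> [[u [xu /IHw[y [uy yz]]]]|[y [[u [xu uy]] yz]]].
  by exists y; split=> //; exists u.
by exists u; split=> //; apply/IHw; exists y.
Qed.

Lemma cube_path_exists x y : exists w, cube_path ell x w y.
Proof.
have [p] := sc.1 x y; elim: p x => [|e p IHp] x /=; first by move->; exists [::].
case=> <- /IHp[w wP]; exists ([set ell e] :: w); exists (tgt e); split=> //.
exact: edge_diagonal.
Qed.

(** * Squares and commuting labels *)

Lemma tgt_inj (e f : edge X) : src e = src f -> tgt e = tgt f -> e = f.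
Proof.
move=> ef tef; apply: ell_inj => //; apply: set1_inj.
by apply: diagonal_label (edge_diagonal e) _; rewrite ef tef; apply: edge_diagonal.
Qed.

Lemma src_neq_tgt (e : edge X) : src e <> tgt e.
Proof.
rewrite /src /tgt => /corner_inj/ffunP/(_ ord0).
by rewrite !ffunE.
Qed.

(** Corners of a square are distinct, so two sides with a common source leave the same corner, and
    uniqueness of the common endpoint rules out [e = f]. Conversely, distinct edges with a common
    source have distinct targets by [tgt_inj]. *)
Lemma span_squareP (e f : edge X) : src e = src f ->
  span_square e f <-> corner_square e f.
Proof.
move=> ef; split=> [[[x [_ x_uniq]] [c [[a [i ei]] [b [j fj]]]]]|[c [ce cf]]].
  have eab : a = b.
    by apply: (corner_inj (c := c)); rewrite -(src_cedge c a i) ei ef -fj src_cedge.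
  rewrite -eab in fj.
  have [eij|neq_ij] := eqVneq i j.
    have e_f : e = f by rewrite -ei -fj eij.
    case: (@src_neq_tgt e); rewrite -(x_uniq (src e)); last first.
      by split; [left | rewrite -e_f; left].
    by apply: x_uniq; split; [right | rewrite -e_f; right].
  have [d [d0 d1 _ _]] := cube_square c a neq_ij.
  by exists d; rewrite d0 d1.
split; last by exists c; split; [exists (vzero 2), sq0 | exists (vzero 2), sq1].
exists (src e); split; first by split; left.
move=> x [[->|xe] [xf|xf]] //.
- by rewrite ef.
- have /tgt_inj : tgt e = tgt f by rewrite -xe.
  by move=> /(_ ef); rewrite -ce -cf => /axis_inj.
Qed.

(** By (A3), commutation may be tested at any vertex where both labels occur. *)
Lemma lcommuteP (e f : edge X) : src e = src f ->
  lcommute ell (ell e) (ell f) <-> corner_square e f.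
Proof.
move=> ef; rewrite -span_squareP //; split=> [[e' [f' [ef' ee' ff']]]|ef_sq].
  by case: adm => _ _ A3; rewrite (A3 e f e' f').
by exists e, f.
Qed.

Lemma lcommute_sym s t : lcommute ell s t -> lcommute ell t s.
Proof.
move=> [e [f [ef <- <-]]] /(span_squareP ef) /corner_square_sym sq.
by apply/lcommuteP.
Qed.

Lemma lcommute_axis n (c : cell X n) i j : i != j ->
  lcommute ell (ell (axis c i)) (ell (axis c j)).
Proof.
move=> neq_ij; apply/lcommuteP; first by rewrite !src_axis.
by have [d [d0 d1 _ _]] := cube_square c (vzero n) neq_ij; exists d.
Qed.

Lemma flag_label x n (e : 'I_n -> edge X) : (forall i, src (e i) = x) ->
  (forall i j, i != j -> lcommute ell (ell (e i)) (ell (e j))) ->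
  exists c : cell X n, corner c (vzero n) = x /\ forall i, axis c i = e i.
Proof.
case: npc => _ _ flag ex comm; apply: flag => // i j /comm.
by rewrite lcommuteP // !ex.
Qed.

(** * Portraits of automorphisms *)

Lemma induced_rcons (sg : portrait_family Sig0) w a :
  induced sg (rcons w a) = rcons (induced sg w) (sg w a).
Proof.
rewrite /induced size_rcons mkseqS nth_rcons ltnn eqxx -!cats1 take_size_cat //.
congr (_ ++ _); apply/eq_in_map => i; rewrite mem_iota => /= lt_iw.
by rewrite takel_cat 1?ltnW // nth_cat lt_iw.
Qed.

Lemma size_induced (sg : portrait_family Sig0) w : size (induced sg w) = size w.
Proof. exact: size_mkseq. Qed.

Lemma Lcube_rcons o v a :
  Lcube ell o (rcons v a) <-> Sigma_at ell o v a.
Proof.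
split=> [[z /cube_path_rcons[y [vy yz]]]|[y [z [vy yz]]]]; first by exists y, z.
by exists z; apply/cube_path_rcons; exists y.
Qed.

Lemma Sigma_at_Lcube o v a : Sigma_at ell o v a -> Lcube ell o v.
Proof. by move=> [x [_ [vx _]]]; exists x. Qed.

Lemma cube_path_edge o v e :
  cube_path ell o v (src e) -> cube_path ell o (rcons v [set ell e]) (tgt e).
Proof.
by move=> ve; apply/cube_path_rcons; exists (src e); split=> //; apply: edge_diagonal.
Qed.

Lemma induced_inj o sg v w : is_portrait ell o sg ->
  Lcube ell o v -> Lcube ell o w -> induced sg v = induced sg w -> v = w.
Proof.
move=> portrait; elim/last_ind: v w => [|v a IHv] w Lv Lw E.
  by apply/esym/nilP; rewrite /nilp -(size_induced sg) -E.
case/lastP: w Lw E => [|w b] Lw E.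
  by have := congr1 size E; rewrite !size_induced size_rcons.
have /Lcube_rcons Sv := Lv; have /Lcube_rcons Sw := Lw.
move: E; rewrite !induced_rcons => /rcons_inj[Evw Eab].
have vw : v = w by apply: IHv Evw; apply: Sigma_at_Lcube; [exact: Sv | exact: Sw].
rewrite -vw in Sw Eab *; congr (rcons v _).
exact: (portrait v (Sigma_at_Lcube Sv)).2 Eab.
Qed.

(** * Conditions satisfied by the portrait of an automorphism *)

Section Portrait.
Variables (o : vertex X) (sg : portrait_family Sig0) (g : morphism X X).
Hypotheses (g_aut : automorphism g) (go : g 0 o = o).
Hypothesis g_sg : portrait_of ell o g sg.

Lemma mor_src e : src (g 1 e) = g 0 (src e).
Proof. by rewrite /src mor_corner. Qed.

Lemma mor_tgt e : tgt (g 1 e) = g 0 (tgt e).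
Proof. by rewrite /tgt mor_corner. Qed.

Lemma mor_redge e : g 1 (redge e) = redge (g 1 e).
Proof. exact: mor_cedge. Qed.

Lemma mor_axis n (c : cell X n) i : axis (g n c) i = g 1 (axis c i).
Proof. exact/esym/mor_cedge. Qed.

(** The image diagonal has the left side as label because [g] has portrait [sg], and the right side
    because [g] maps the cube [c]; its endpoints determine the label. *)
Lemma portrait_cube v n (c : cell X n) : 0 < n ->
  cube_path ell o v (corner c (vzero n)) ->
  sg v [set ell (axis c i) | i : 'I_n] = [set ell (g 1 (axis c i)) | i : 'I_n].
Proof.
move=> n0 vc; pose y := corner c (vopp (vzero n)).
have cy : diagonal ell (corner c (vzero n)) y [set ell (axis c i) | i : 'I_n].
  by apply/diagonalP; exists n, c.
apply: diagonal_label (g_sg vc cy) _; apply/diagonalP; exists n, (g n c).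
by split; rewrite ?mor_corner //; apply: eq_imset => i; rewrite mor_axis.
Qed.

Lemma portrait_edge v e : cube_path ell o v (src e) ->
  sg v [set ell e] = [set ell (g 1 e)].
Proof.
move=> ve; apply: diagonal_label (g_sg ve (edge_diagonal e)) _.
by rewrite -mor_src -mor_tgt; apply: edge_diagonal.
Qed.

Lemma automorphism_corner_square e f :
  corner_square (g 1 e) (g 1 f) <-> corner_square e f.
Proof.
have g_inj := bij_inj (g_aut 1).
split=> [[d [de df]]|[c [<- <-]]]; last by exists (g 2 c); rewrite !mor_axis.
have [h _ hK] := g_aut 2; exists (h d).
by split; apply: g_inj; rewrite -mor_axis hK.
Qed.

Lemma portrait_admissible : admissible_portrait ell o sg.
Proof.
split=> [v w [x [vx wx]] a [x' [y [vx' xy]]]|v [x vx]].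
  rewrite (cube_path_fun vx' vx) in xy.
  exact: diagonal_label (g_sg vx xy) (g_sg wx xy).
(* The default [s] is taken only where [sg v [set s]] is no singleton, which never happens for the
   label of an edge at [x]. *)
pose tau s := odflt s [pick t | sg v [set s] == [set t]].
have tauE e : src e = x -> tau (ell e) = ell (g 1 e).
  move=> ex; rewrite -ex in vx; rewrite /tau portrait_edge //.
  case: pickP => [t /eqP/set1_inj //|/(_ (ell (g 1 e)))].
  by rewrite eqxx.
have label s : Sigma0_at ell o v s -> exists e, src e = x /\ ell e = s.
  by move=> [y [e [vy ey es]]]; exists e; rewrite ey (cube_path_fun vy vx).
exists tau; split=> [s /label[e [ex <-]]|| a [x' [y [vx' /diagonalP[n [c [n0 cx _ ->]]]]]]].
- by rewrite tauE // portrait_edge // ex.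
- split=> s t /label[e [ex <-]] /label[f [fx <-]]; rewrite !tauE //.
    move=> E; congr ell; apply: (bij_inj (g_aut 1)); apply: ell_inj E.
    by rewrite !mor_src ex fx.
  by rewrite !lcommuteP ?automorphism_corner_square // ?mor_src ex fx.
- rewrite (cube_path_fun vx' vx) in cx.
  rewrite portrait_cube ?cx // -imset_comp; apply: eq_imset => i /=.
  by rewrite tauE // src_axis.
Qed.

Lemma portrait_path v x : cube_path ell o v x -> cube_path ell o (induced sg v) (g 0 x).
Proof.
elim/last_ind: v x => [|v a IHv] x; first by move=> /= <-; rewrite go.
move=> /cube_path_rcons[y [vy yx]]; rewrite induced_rcons.
by apply/cube_path_rcons; exists (g 0 y); split; [apply: IHv | apply: g_sg vy yx].
Qed.

Lemma portrait_tree_automorphism :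
  is_portrait ell o sg -> defines_tree_automorphism ell o sg.
Proof.
move=> portrait; have F_inj := induced_inj portrait.
have F_L v : Lcube ell o v -> Lcube ell o (induced sg v).
  by move=> [x vx]; exists (g 0 x); apply: portrait_path.
have F_child v w : Lcube ell o v -> Lcube ell o w ->
    tree_child ell o v w <-> tree_child ell o (induced sg v) (induced sg w).
  move=> Lv Lw; split=> [[_ [a [va wE]]]|[_ [b [_ Fw]]]].
    split; first exact: F_L.
    exists (sg v a); rewrite wE induced_rcons; split=> //.
    by apply/Lcube_rcons; rewrite -induced_rcons; apply: F_L; apply/Lcube_rcons.
  split=> //; case/lastP: w Lw Fw => [|w a] Lw.
    by move/(congr1 size); rewrite size_rcons size_induced.
  have /Lcube_rcons wa := Lw.
  rewrite induced_rcons => /rcons_inj[/(F_inj _ _ (Sigma_at_Lcube wa) Lv) <- _].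
  by exists a.
split=> //.
  (* Surjectivity on words: the cube of the last diagonal is pulled back through the inverse [h] of
     [g] on cells. *)
  elim/last_ind => [|w b IHw] Lw; first by exists [::]; split.
  have /Lcube_rcons Sw := Lw; have [v [Lv FvE]] := IHw (Sigma_at_Lcube Sw).
  have [y [z [wy yz]]] := Sw; have [x vx] := Lv.
  have yE : y = g 0 x by apply: cube_path_fun wy _; rewrite -FvE; apply: portrait_path.
  have [n [d [n0 dy _ bE]]] := (diagonalP y z b).1 yz.
  have [h hK gK] := g_aut n; pose c := h d.
  have cx : corner c (vzero n) = x.
    by apply: (bij_inj (g_aut 0)); rewrite mor_corner gK dy.
  have va : Sigma_at ell o v [set ell (axis c i) | i : 'I_n].
    by exists x, (corner c (vopp (vzero n))); split=> //; apply/diagonalP; exists n, c.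
  exists (rcons v [set ell (axis c i) | i : 'I_n]); split; first exact/Lcube_rcons.
  rewrite induced_rcons FvE portrait_cube ?cx // bE; congr rcons.
  by apply: eq_imset => i; rewrite -mor_axis gK.
move=> v w Lv Lw; rewrite /tree_adjacent.
by rewrite (F_child v w Lv Lw) (F_child w v Lw Lv).
Qed.

(** A cube labeled [b] and an edge labeled [s] commuting with it span a larger cube [d]. Its face
    [c'] at the far end of the edge has the same labels as [c], and this parallelism persists under
    [g]. *)
Lemma portrait_par : par ell o sg.
Proof.
move=> v s b _ [x [e [vx ex <-]]] _ [x' [y [vx' /diagonalP[n [c [n0 cx _ bE]]]]]] comm.
rewrite (cube_path_fun vx' vx) -ex in cx; rewrite -ex in vx => {x' vx' ex x y}.
pose ax (k : 'I_n.+1) := if unlift ord0 k is Some i then axis c i else e.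
have src_ax k : src (ax k) = src e.
  by rewrite /ax; case: unliftP => [i|] _ //; rewrite src_axis.
have comm_e i : lcommute ell (ell (axis c i)) (ell e).
  by apply: comm; rewrite ?set11 // bE imset_f.
have [|d [d0 dax]] := flag_label src_ax.
  rewrite /ax => k l; case: unliftP => [i|] ->; case: unliftP => [j|] -> //.
  - by rewrite (inj_eq lift_inj) => /lcommute_axis.
  - by move=> _; apply: lcommute_sym.
have d_lift i : axis d (lift ord0 i) = axis c i by rewrite dax /ax liftK.
pose c' := res (subface (vunit ord0) (@lift_inj _ (ord0 : 'I_n.+1))) d.
have c'ax i : axis c' i = cedge d (vunit ord0) (lift ord0 i).
  by rewrite /axis cedge_subface subface0.
have c'0 : corner c' (vzero n) = tgt e.
  by rewrite corner_res subfaceE subface0 -tgt_axis dax /ax unlift_none.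
have lab (d' : cell X n.+1) i :
    ell (cedge d' (vunit ord0) (lift ord0 i)) = ell (axis d' (lift ord0 i)).
  by rewrite (ell_cedge d') ffunE eq_sym (negPf (neq_lift _ _)).
have bE' : b = [set ell (axis c' i) | i : 'I_n].
  by rewrite bE; apply: eq_imset => i; rewrite c'ax lab d_lift.
rewrite {1}bE bE' !portrait_cube ?cx // ?c'0; last exact: cube_path_edge.
by apply: eq_imset => i; rewrite c'ax mor_cedge lab mor_axis d_lift.
Qed.

(** In the cube labeled [a], the edge [e] labeled [s] that ends at the far corner [top] starts where
    the word with [s] removed from [a] ends. The condition compares the images of [e] and of its
    reverse. *)
Lemma portrait_inv : inv_condition inv ell o sg.
Proof.
move=> w a s [y /cube_path_rcons[x [wx xy]]] sa.
have /diagonalP[[|n] [c [n_gt0 cx cy aE]]] := xy; first by [].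
have /imsetP[i _ sE] : s \in [set ell (axis c i) | i : 'I_n.+1] by rewrite -aE.
pose top : vtx n.+1 := vopp (vzero n.+1); pose e := cedge c (flip top i) i.
have topE k : top k by rewrite !ffunE.
have eE : ell e = s by rewrite (ell_cedge c) ffunE topE eqxx.
have re : redge e = cedge c top i by rewrite redge_cedge flip_flip.
have wa : cube_path ell o (rcons w a) (src (redge e)).
  by rewrite re src_cedge cy; apply/cube_path_rcons; exists x.
set v := (if _ then _ else _).
rewrite -[in LHS]eE -ell_redge portrait_edge // mor_redge ell_redge.
suff ve : cube_path ell o v (src e).
  by rewrite -eE portrait_edge ?imset_set1.
rewrite {}/v; have asE j : ell (axis c j) \in a :\ s -> j != i.
  by rewrite !inE => /andP[+ _]; apply: contraNneq => ->; rewrite -sE.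
have asI j : j != i -> ell (axis c j) \in a :\ s.
  move=> neq_ji; rewrite !inE aE imset_f // andbT sE.
  by rewrite (inj_eq (@ell_axis_inj _ c)).
(* For [a = [set s]] the edge [e] starts at the origin; otherwise the face at the origin without
   direction [i] leads to its source and is labeled [a :\ s]. *)
case: eqP => [as0|/eqP/set0Pn[t tas]].
  rewrite src_cedge (_ : flip top i = vzero n.+1) ?cx //.
  apply/ffunP => j; rewrite !ffunE /=; case: eqVneq => [//|/asI].
  by rewrite as0 inE.
apply/cube_path_rcons; exists x; split=> //; apply/diagonalP.
exists n, (res (subface (vzero n.+1) (@lift_inj _ i)) c).
have axE j : axis (res (subface (vzero n.+1) (@lift_inj _ i)) c) j = axis c (lift i j).
  by rewrite /axis cedge_subface subface0.
split.
- have : t \in a by move: tas; rewrite inE => /andP[].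
  rewrite aE => /imsetP[j _ tE]; rewrite tE in tas; have := asE j tas.
  by case: (unliftP i j) => [[k lt_k] _ _|->]; [apply: leq_ltn_trans lt_k | rewrite eqxx].
- by rewrite corner_res subfaceE subface0.
- rewrite corner_res subfaceE src_cedge; congr (corner c _); apply/ffunP => j.
  case: (unliftP i j) => [k|] ->; rewrite ?subface_in //; try exact: lift_inj.
    by rewrite !ffunE eq_sym (negPf (neq_lift _ _)).
  by rewrite subface_notin => [|k]; rewrite ?ffunE ?topE ?eqxx // eq_sym neq_lift.
- apply/setP => r; apply/idP/imsetP => [ras|[j _ ->]].
    have : r \in a by move: ras; rewrite inE => /andP[].
    rewrite aE => /imsetP[j _ rE]; rewrite rE in ras; have := asE j ras.
    case: (unliftP i j) => [k jE|->]; rewrite ?eqxx // => _.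
    by exists k; rewrite // axE -jE.
  by rewrite axE; apply: asI; rewrite eq_sym neq_lift.
Qed.

End Portrait.

(** * From portraits to automorphisms *)

Section LinkMaps.
(** [tau x] prescribes the labels of the images of the edges at [x], and [I x y] says that [y] is an
    eligible image of [x]. *)
Variables (o : vertex X) (tau : vertex X -> Sig0 -> Sig0).
Variable I : vertex X -> vertex X -> Prop.
Hypothesis tau_square : forall e f, corner_square e f ->
  tau (tgt e) (ell f) = tau (src e) (ell f).
Hypothesis tau_inv : forall e, tau (tgt e) (inv (ell e)) = inv (tau (src e) (ell e)).
Hypothesis tau_inj : forall e f, src e = src f ->
  tau (src e) (ell e) = tau (src e) (ell f) -> ell e = ell f.
Hypothesis tau_comm : forall e f, src e = src f ->
  lcommute ell (ell e) (ell f) <->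
  lcommute ell (tau (src e) (ell e)) (tau (src e) (ell f)).
Hypothesis I_base : I o o.
Hypothesis I_edge : forall e y, I (src e) y -> exists e',
  [/\ src e' = y, ell e' = tau (src e) (ell e) & I (tgt e) (tgt e')].
Hypothesis I_surj : forall x e', I x (src e') ->
  exists e, src e = x /\ ell e' = tau x (ell e).

Lemma tau_square_flip (c : cell X 2) :
  tau (tgt (axis c sq0)) (ell (cedge c (vunit sq0) sq1)) =
    tau (corner c (vzero 2)) (ell (axis c sq1)) /\
  tau (tgt (axis c sq1)) (ell (cedge c (vunit sq1) sq0)) =
    tau (corner c (vzero 2)) (ell (axis c sq0)).
Proof.
rewrite (ell_square c).1 (ell_square c).2.
have c01 : corner_square (axis c sq0) (axis c sq1) by exists c.
by rewrite (tau_square c01) (tau_square (corner_square_sym c01)) !src_axis.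
Qed.

(** The endpoint of the edge at [y] labeled [s], unique by (A2); without such an edge the value is
    arbitrary. *)
Definition step y s := epsilon (inhabits y)
  (fun z => exists e, [/\ src e = y, ell e = s & tgt e = z]).

Lemma stepE e y s : src e = y -> ell e = s -> step y s = tgt e.
Proof.
move=> ey es; rewrite /step; have := @epsilon_spec _ (inhabits y)
  (fun z => exists e, [/\ src e = y, ell e = s & tgt e = z]).
by case=> [|f [fy fs <-]]; [exists (tgt e), e | rewrite (@ell_inj f e) ?fy ?fs].
Qed.

(** Transport of the image vertex. Backtracking is undone by [tau_inv]. For a square, [tau_comm]
    makes the image edges span a square [d], whose far sides carry the prescribed labels by
    [tau_square]. *)
Lemma vertex_map_exists : exists G : vertex X -> vertex X,
  [/\ G o = o, forall x, I x (G x)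
    & forall e, G (tgt e) = step (G (src e)) (tau (src e) (ell e))].
Proof.
apply: (transport (st := fun e y => step y (tau (src e) (ell e)))) => //.
- by move=> e y /I_edge[e' [ey es Ie]]; rewrite (stepE ey es).
- move=> e y /I_edge[e' [ey es _]]; rewrite (stepE ey es) src_redge ell_redge.
  by rewrite tau_inv -es -ell_redge (stepE (src_redge e')) // tgt_redge.
move=> c y Iy; set e := axis c sq0; set f := axis c sq1.
have src_e : src e = corner c (vzero 2) by exact: src_axis.
have src_f : src f = corner c (vzero 2) by exact: src_axis.
have [e' [ey es _]] : exists e', [/\ src e' = y, ell e' = tau (src e) (ell e)
    & I (tgt e) (tgt e')] by apply: I_edge; rewrite src_e.
have [f' [fy fs _]] : exists f', [/\ src f' = y, ell f' = tau (src f) (ell f)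
    & I (tgt f) (tgt f')] by apply: I_edge; rewrite src_f.
have [d [de df]] : corner_square e' f'.
  apply/lcommuteP; rewrite ?ey // es fs src_f -src_e -tau_comm ?src_e //.
  exact: lcommute_axis.
rewrite (stepE ey es) (stepE fy fs) !src_cedge -flip_vzero -tgt_cedge.
have [fl0 fl1] := tau_square_flip c.
rewrite -/(axis c sq0) -/e flip_vzero fl0 -src_f -fs.
rewrite -[corner c (vunit sq1)]tgt_axis fl1 -src_e -es -de -df.
have [d0 d1] := ell_square d.
rewrite (@stepE (cedge d (vunit sq0) sq1)) ?src_cedge ?tgt_axis //.
rewrite (@stepE (cedge d (vunit sq1) sq0)) ?src_cedge ?tgt_axis //.
rewrite !tgt_cedge; congr (corner d _); apply/ffunP => j; rewrite !ffunE.
exact: addbC.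
Qed.

(** * Extension of the vertex map to cubes *)

Section Extend.
Variable G : vertex X -> vertex X.
Hypotheses (Go : G o = o) (I_G : forall x, I x (G x)).
Hypothesis G_tgt : forall e, G (tgt e) = step (G (src e)) (tau (src e) (ell e)).

Definition lifts_to (e e' : edge X) : Prop :=
  src e' = G (src e) /\ ell e' = tau (src e) (ell e).

Lemma lifts_tgt e e' : lifts_to e e' -> tgt e' = G (tgt e).
Proof. by case=> es el; rewrite G_tgt (stepE es el). Qed.

Lemma lifts_redge e e' : lifts_to e e' -> lifts_to (redge e) (redge e').
Proof.
move=> ee'; have te := lifts_tgt ee'; case: ee' => es el.
by split; rewrite !src_redge ?te // !ell_redge tau_inv el.
Qed.

Lemma lifts_exists e : exists e', lifts_to e e'.
Proof. by have [e' [es el _]] := I_edge (I_G (src e)); exists e'. Qed.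

Lemma lifts_inj e f e' : src e = src f -> lifts_to e e' -> lifts_to f e' -> e = f.
Proof.
move=> ef [_ el] [_ fl]; apply: ell_inj => //; apply: tau_inj => //.
by rewrite -el fl ef.
Qed.

Lemma lifts_surj x e' : src e' = G x -> exists e, src e = x /\ lifts_to e e'.
Proof.
move=> ex; have [|e [es el]] := @I_surj x e'; first by rewrite ex.
by exists e; rewrite /lifts_to es.
Qed.

Lemma lifts_square e f e' f' : src e = src f -> lifts_to e e' -> lifts_to f f' ->
  corner_square e f <-> corner_square e' f'.
Proof.
move=> ef [es el] [fs fl].
by rewrite -!lcommuteP ?es ?fs ?ef // tau_comm // el fl ef.
Qed.

Definition cube_lifts n (c c' : cell X n) : Prop :=
  corner c' (vzero n) = G (corner c (vzero n)) /\
  forall i, lifts_to (axis c i) (axis c' i).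

(** Along direction [j] an edge is reversed, which [lifts_redge] covers. An edge in another
    direction keeps its label, and [tau_square] gives the same prescription at both ends. *)
Lemma cube_lifts_face n (c c' : cell X n) a : cube_lifts c c' ->
  corner c' a = G (corner c a) /\ forall i, lifts_to (cedge c a i) (cedge c' a i).
Proof.
case=> cc' ax; elim/vtx_ind: a => // a j aj [IH0 IH1].
have corner_flip : corner c' (flip a j) = G (corner c (flip a j)).
  by rewrite -!tgt_cedge; apply: lifts_tgt.
split=> // i; have [->|neq_ij] := eqVneq i j.
  by rewrite -!redge_cedge; apply: lifts_redge.
split; first by rewrite !src_cedge.
have ell_flip (d : cell X n) : ell (cedge d (flip a j) i) = ell (cedge d a i).
  by rewrite (ell_cedge d (flip a j)) (ell_cedge d a) ffunE (negPf neq_ij) addbF.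
rewrite !ell_flip (IH1 i).2 src_cedge.
have sq : corner_square (cedge c a j) (cedge c a i).
  have [d [d0 d1 _ _]] := cube_square c a neq_ij.
  by apply: corner_square_sym; exists d.
by rewrite (src_cedge c (flip a j)) -tgt_cedge (tau_square sq) src_cedge.
Qed.

Lemma cube_lifts_res m n (f : face_map m n) (c c' : cell X n) :
  cube_lifts c c' -> cube_lifts (res f c) (res f c').
Proof.
move=> cc'; split=> [|i]; first by rewrite !corner_res; apply: (cube_lifts_face _ cc').1.
rewrite /axis; have [j fE] := @cedge_res X _ _ f (vzero m) i.
by rewrite !fE; apply: (cube_lifts_face _ cc').2.
Qed.

Lemma cube_lifts_fun n (c d d' : cell X n) :
  cube_lifts c d -> cube_lifts c d' -> d = d'.
Proof.
case=> d0 dax [d'0 d'ax]; case: npc => _ cube_eq _.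
apply: cube_eq => [|i]; first by rewrite d0 d'0.
by apply: ell_inj; rewrite ?(dax i).1 ?(d'ax i).1 ?(dax i).2 ?(d'ax i).2.
Qed.

Lemma cube_lifts_exists n (c : cell X n) : exists c', cube_lifts c c'.
Proof.
have /functional_choice[e eP] i := lifts_exists (axis c i).
case: npc => _ _ flag.
have [i|i j neq_ij|c' [c'0 c'ax]] := flag (G (corner c (vzero n))) n e.
- by rewrite (eP i).1 src_axis.
- rewrite -(lifts_square _ (eP i) (eP j)) ?src_axis //.
  by have [d [d0 d1 _ _]] := cube_square c (vzero n) neq_ij; exists d.
by exists c'; split=> // i; rewrite c'ax.
Qed.

(** The axes of [c'] lift to edges at [x] by [I_surj]; [tau_comm], read backwards, makes them
    commute, and flagness at [x] fills them with a cube. *)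
Lemma cube_lifts_surj x n (c' : cell X n) : corner c' (vzero n) = G x ->
  exists c, corner c (vzero n) = x /\ cube_lifts c c'.
Proof.
move=> c'x; have /functional_choice[e eP] i :
    exists e, src e = x /\ lifts_to e (axis c' i).
  by apply: lifts_surj; rewrite src_axis.
case: npc => _ _ flag; have [i|i j neq_ij|c [c0 cax]] := flag x n e.
- exact: (eP i).1.
- rewrite (lifts_square _ (eP i).2 (eP j).2) ?(eP i).1 ?(eP j).1 //.
  by have [d [d0 d1 _ _]] := cube_square c' (vzero n) neq_ij; exists d.
exists c; split=> //; split=> [|i]; first by rewrite c0.
by rewrite cax; apply: (eP i).2.
Qed.

Lemma cube_lifts_inj n (c d c' : cell X n) :
  corner c (vzero n) = corner d (vzero n) ->
  cube_lifts c c' -> cube_lifts d c' -> c = d.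
Proof.
move=> cd [_ cax] [_ dax]; case: npc => _ cube_eq _; apply: cube_eq => // i.
by apply: lifts_inj (cax i) (dax i); rewrite !src_axis.
Qed.

(** Edges lift uniquely through [G] once the source is given, and squares lift too, so endpoints of
    lifts can be transported, the state over [y] being a preimage of [y]. The resulting [h] is a
    right inverse of [G] by this invariant and a left inverse by induction along a path from [o]. *)
Lemma vertex_map_bij : bijective G.
Proof.
pose st e' x := epsilon (inhabits x)
  (fun z => exists e, [/\ src e = x, tgt e = z & lifts_to e e']).
have stE e e' : lifts_to e e' -> st e' (src e) = tgt e.
  move=> ee'; rewrite /st; have := @epsilon_spec _ (inhabits (src e))
    (fun z => exists f, [/\ src f = src e, tgt f = z & lifts_to f e']).
  case=> [|f [fe <- fe']]; first by exists (tgt e), e.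
  by rewrite (lifts_inj fe fe' ee').
have [||c y yc|h [ho Gh h_tgt]] :=
    @transport X _ st (fun y x => G x = y) _ _ _ o o sc Go.
- move=> e' x /esym/lifts_surj[e [<- ee']].
  by rewrite (stE _ _ ee') (lifts_tgt ee').
- move=> e' x /esym/lifts_surj[e [<- ee']].
  by rewrite (stE _ _ ee') -src_redge (stE _ _ (lifts_redge ee')) tgt_redge.
- have [d [<- dc]] := cube_lifts_surj (esym yc); have face a := (cube_lifts_face a dc).2.
  rewrite -{1}(src_axis d sq0) -(src_axis d sq1) !(stE _ _ (face (vzero 2) _)).
  rewrite !tgt_cedge !flip_vzero -{1}(src_cedge d (vunit sq0) sq1).
  rewrite -(src_cedge d (vunit sq1) sq0) !(stE _ _ (face _ _)) !tgt_cedge.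
  by congr (corner d _); apply/ffunP => j; rewrite !ffunE addbC.
exists h => // x; have [p] := sc.1 o x.
elim/last_ind: p x => [|p e IHp] x /=; first by move=> <-; rewrite Go.
rewrite -cats1 => /is_path_cat[y [/IHp hy [ey /= <-]]].
have [e' ee'] := lifts_exists e.
by rewrite -(lifts_tgt ee') h_tgt ee'.1 ey hy -ey; apply: stE.
Qed.

Lemma vertex_map_extends : exists g : morphism X X,
  [/\ automorphism g, g 0 o = o & forall e, ell (g 1 e) = tau (src e) (ell e)].
Proof.
pose g n (c : cell X n) :=
  proj1_sig (constructive_indefinite_description _ (cube_lifts_exists c)).
have gP n (c : cell X n) : cube_lifts c (g n c).
  exact: proj2_sig (constructive_indefinite_description _ (cube_lifts_exists c)).
(* The image cube is unique, so the choice commutes with passing to faces. *)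
have g_res m n (f : face_map m n) (c : cell X n) : g m (res f c) = res f (g n c).
  exact: cube_lifts_fun (gP _ _) (cube_lifts_res f (gP n c)).
have [h hK Gh] := vertex_map_bij.
exists (Morphism g_res); split=> [n||e] /=.
- have inv_ex (c' : cell X n) : exists c, cube_lifts c c'.
    have [|c [_ cc']] := @cube_lifts_surj (h (corner c' (vzero n))) n c'.
      by rewrite Gh.
    by exists c.
  have [k kP] := functional_choice _ inv_ex.
  exists k => [c|c']; last exact: cube_lifts_fun (gP n _) (kP c').
  apply: cube_lifts_inj (kP _) (gP n c); apply: (can_inj hK).
  by rewrite -(kP _).1 (gP n c).1.
- by rewrite -(cell0E (g 0 o) (vzero 0)) (gP 0 o).1 cell0E.
- by have [_ /(_ ord0)[_]] := gP 1 e; rewrite !cell1E.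
Qed.

End Extend.

Lemma link_maps_extend : exists g : morphism X X,
  [/\ automorphism g, g 0 o = o & forall e, ell (g 1 e) = tau (src e) (ell e)].
Proof.
by have [G [Go IG Gt]] := vertex_map_exists; apply: vertex_map_extends Go IG Gt.
Qed.

End LinkMaps.

(** * Link maps read off from a portrait *)

Lemma portrait_extends o sg :
  admissible_portrait ell o sg -> defines_tree_automorphism ell o sg ->
  par ell o sg -> inv_condition inv ell o sg ->
  exists g : morphism X X, [/\ automorphism g, g 0 o = o & portrait_of ell o g sg].
Proof.
move=> [sg_equiv sg_tau] [F_L F_inj F_surj _ _] sg_par sg_inv.
(* A word leading to [x] is chosen to define [tau x]; equivalent words have equal portrait values,
   so [tau x] works for every word ending at [x]. *)
have /functional_choice[tau tauP] x : exists t : Sig0 -> Sig0,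
    [/\ forall v y a, cube_path ell o v x -> diagonal ell x y a -> sg v a = t @: a,
        forall e f, src e = x -> src f = x -> t (ell e) = t (ell f) -> ell e = ell f
      & forall e f, src e = x -> src f = x ->
          lcommute ell (ell e) (ell f) <-> lcommute ell (t (ell e)) (t (ell f))].
  have [w wx] := cube_path_exists o x.
  have [|t [_ [t_inj t_comm] t_sg]] := sg_tau w; first by exists x.
  have label e : src e = x -> Sigma0_at ell o w (ell e) by move=> ex; exists x, e.
  exists t; split=> [v y a vx xy|e f ex fx|e f ex fx]; last 2 first.
  - by apply: t_inj; apply: label.
  - by apply: t_comm; apply: label.
  rewrite (sg_equiv v w); [|by exists x|by exists x, y].
  by apply: t_sg; exists x, y.
have tauE v e : cube_path ell o v (src e) ->
    sg v [set ell e] = [set tau (src e) (ell e)].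
  move=> ve; have [tau_sg _ _] := tauP (src e).
  by rewrite (tau_sg _ _ _ ve (edge_diagonal e)) imset_set1.
(* Eligible images of [x] are the endpoints of the image words of words leading to [x]. *)
pose I x y := exists w, cube_path ell o w x /\ cube_path ell o (induced sg w) y.
have [|||||||g [g_aut go gE]] := @link_maps_extend o tau I.
- move=> e f ef_sq; have [c [ce cf]] := ef_sq.
  have ef : src e = src f by rewrite -ce -cf !src_axis.
  have comm_ef : lcommute ell (ell e) (ell f) by apply/lcommuteP.
  have [v ve] := cube_path_exists o (src e); have vf := ve; rewrite ef in vf.
  have [f' [f's f'l]] : exists f', src f' = tgt e /\ ell f' = ell f.
    exists (cedge c (vunit sq0) sq1); rewrite src_cedge -tgt_axis ce -cf.
    by rewrite (ell_square c).2.
  have vf' : cube_path ell o (rcons v [set ell e]) (src f').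
    by rewrite f's; apply: cube_path_edge.
  apply: set1_inj; rewrite -{1}f'l -f's -(tauE _ _ vf') f'l -sg_par.
  - by rewrite ef tauE.
  - by exists (src e).
  - by exists (src e), e.
  - by move/(_ (ell f)).
  - by exists (src e), (tgt f); rewrite {2}ef; split=> //; apply: edge_diagonal.
  - by move=> s t /set1P-> /set1P->; apply: lcommute_sym.
- move=> e; have [v ve] := cube_path_exists o (src e).
  have vse := cube_path_edge ve; apply: set1_inj.
  rewrite -ell_redge -src_redge -(tauE (rcons v [set ell e])) ?src_redge //.
  (* (inv) is used for the last letter [[set ell e]], where removing the label leaves the word [v]
     itself. *)
  rewrite ell_redge sg_inv ?set11 //; last by exists (tgt e).
  by rewrite setDv eqxx tauE // imset_set1.
- by move=> e f ef; have [_ t_inj _] := tauP (src e); apply: t_inj.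
- by move=> e f ef; have [_ _ t_comm] := tauP (src e); apply: t_comm.
- by exists [::].
- move=> e y [w [we wy]]; have wt := cube_path_edge we.
  have [|z] := F_L (rcons w [set ell e]); first by exists (tgt e).
  rewrite induced_rcons => wz.
  have [y' [wy' y'z]] := (cube_path_rcons _ _ _ _).1 wz.
  rewrite (cube_path_fun wy' wy) tauE // in y'z.
  have [e' [ey ez el]] := diagonal_edge y'z; exists e'; split=> //.
  by exists (rcons w [set ell e]); rewrite ez induced_rcons.
(* The image word of [w] extended by [ell e'] is the image of some word; injectivity forces its
   prefix to be [w]. Its last letter maps onto a singleton, so any axis of its cube gives the
   required edge. *)
- move=> x e' [w [wx we']].
  have [|u [[z uz]]] := F_surj (rcons (induced sg w) [set ell e']).
    by exists (tgt e'); apply: cube_path_edge.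
  case/lastP: u uz => [|u a] uz; first by move/(congr1 size); rewrite size_rcons.
  rewrite induced_rcons => /rcons_inj[].
  have [y [uy yz]] := (cube_path_rcons _ _ _ _).1 uz.
  have Lu : Lcube ell o u by exists y.
  have Lw : Lcube ell o w by exists x.
  move=> /(F_inj _ _ Lu Lw) uw; rewrite {}uw in uy * => Ea.
  have [tau_sg _ _] := tauP x; rewrite (cube_path_fun uy wx) in yz.
  move: Ea; rewrite (tau_sg w z a wx yz).
  have [n [c [n0 cx _ ->]]] := (diagonalP _ _ _).1 yz => Ea.
  exists (axis c (Ordinal n0)); rewrite src_axis cx; split=> //.
  by apply/esym/set1P; rewrite -Ea !imset_f.
exists g; split=> // v x y a vx xy.
have [tau_sg _ _] := tauP x; rewrite (tau_sg v y a vx xy).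
move: xy => /diagonalP[n [c [n0 cx cy ->]]]; apply/diagonalP; exists n, (g n c).
split; rewrite -?mor_corner ?cx ?cy // -imset_comp; apply: eq_imset => i /=.
by rewrite mor_axis gE src_axis cx.
Qed.

End Labeled.

Theorem theorem10 :
  forall (S X : cube_complex) (p : morphism X S)
    (Sig0 : finType) (inv : Sig0 -> Sig0) (ell : edge X -> Sig0)
    (o : vertex X) (sg : portrait_family Sig0),
  compact S -> connected S -> nonpositively_curved S -> special S ->
  universal_covering p ->
  fixpoint_free_involution inv ->
  admissible_labeling inv ell ->
  label_invariant ell p ->
  is_portrait ell o sg ->
  ((exists g : morphism X X,
      [/\ automorphism g, g 0 o = o & portrait_of ell o g sg]) <->
   [/\ admissible_portrait ell o sg, defines_tree_automorphism ell o sg,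
       par ell o sg & inv_condition inv ell o sg]).
Proof.
move=> S X p Sig0 inv ell o sg _ _ npcS _ [cov sc] inv_ffi adm _ portrait.
have npc := covering_npc cov npcS.
split=> [[g [g_aut go g_sg]]|[sg_adm sg_tree sg_par sg_inv]].
  split.
  - exact: (portrait_admissible npc sc inv_ffi adm g_aut g_sg).
  - exact: (portrait_tree_automorphism npc sc inv_ffi adm g_aut go g_sg portrait).
  - exact: (portrait_par npc sc inv_ffi adm g_sg).
  - exact: (portrait_inv npc sc inv_ffi adm g_sg).
exact: (portrait_extends npc sc inv_ffi adm sg_adm sg_tree sg_par sg_inv).
Qed.
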